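(* The functor $\mathrm{Sklin}:\mathbf{SKern}\to\mathbf{ICones}$, mapping $X$ to $\mathcal{M}(X)$ and a substochastic kernel $\kappa$ from $X$ to $Y$ to the map $\mu\mapsto\big(V\mapsto\int\kappa(r,V)\,\mu(dr)\big)$, is full and faithful.
   Context: Cones. A precone is a module $P$ over $\mathbb{R}_{\ge 0}$ with $x_1+x=x_2+x\Rightarrow x_1=x_2$ and $x_1+x_2=0\Rightarrow x_1=0$, ordered by $x\le y$ iff $y=x+z$ for some $z$. A cone is a precone with $\|\cdot\|:P\to\mathbb{R}_{\ge0}$ such that $\|\lambda x\|=\lambda\|x\|$, $\|x\|=0\Rightarrow x=0$, $\|x+y\|\le\|x\|+\|y\|$, $\|x\|\le\|x+y\|$, and every increasing sequence in $\mathcal{B}P=\{x:\|x\|\le 1\}$ has a lub in $P$ lying in $\mathcal{B}P$. Continuous = monotone and preserving lubs of norm-bounded increasing sequences; $\|f\|=\sup_{x\in\mathcal{B}P}\|f(x)\|$; $P'$ = cone of linear continuous maps $P\to\mathbb{R}_{\ge0}$. Measurability. Fix a small full subcategory $\mathbf{Ar}$ of measurable spaces, closed under binary products, containing the one-point space $0$, with non-empty objects. A measurability structure on $P$ is a family $(\mathcal{M}_X)_{X\in\mathbf{Ar}}$ of sets of maps $m:X\times P\to\mathbb{R}_{\ge0}$ with $m(r,\cdot)\in P'$ such that: (i) $r\mapsto m(r,x)$ measurable into $[0,1]$ for $x\in\mathcal{B}P$; (ii) $(s,x)\mapsto m(\phi(s),x)\in\mathcal{M}_Y$ for $\phi\in\mathbf{Ar}(Y,X)$;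 (iii) $\mathcal{M}_0$ separates points; (iv) $\|x\|=\sup\{m(x)/\|m\|:m\in\mathcal{M}_0\setminus\{0\}\}$. Paths of arity $X$: bounded $\gamma:X\to C$ with $(s,r)\mapsto m(s,\gamma(r))$ measurable for all $m\in\mathcal{M}_Y$. Integral over finite $\mu$: the $x$ with $m(x)=\int m(\gamma(r))\mu(dr)$ for all $m\in\mathcal{M}_0$. Integrable cone: all such integrals exist. $\mathbf{ICones}$: integrable cones with linear, continuous, norm $\le1$, measurable (paths to paths), integral-preserving maps. $\mathcal{M}(X)$: the integrable cone of finite measures on $X$, pointwise operations, norm $\mu(X)$, tests $(s,\mu)\mapsto\mu(U)$ for $U$ measurable in $X$. $\mathbf{SKern}$: the category whose objects are those of $\mathbf{Ar}$ and whose morphisms $X\to Y$ are substochastic kernels $\kappa$ (kernels with $\kappa(r,Y)\le1$ for all $r$); the identity on $X$ is $r\mapsto\delta_r$ (Dirac measure) and the composite of $\kappa_1:X_1\to X_2$ and $\kappa_2:X_2\to X_3$ is $(r_1,U_3)\mapsto\int\kappa_2(r_2,U_3)\,\kappa_1(r_1,dr_2)$. *)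

(* Defs.v *)
From HB Require Import structures.
From mathcomp Require Import all_boot all_order all_algebra.
From mathcomp Require Import all_classical all_reals all_analysis.
From mathcomp Require Import measurable_realfun.

Set Implicit Arguments.
Unset Strict Implicit.
Unset Printing Implicit Defensive.
Import Order.TTheory GRing.Theory Num.Theory.
Import numFieldNormedType.Exports.
Local Open Scope classical_set_scope.
Local Open Scope ring_scope.

Record category := Category {
  obj :> Type ;
  hom : obj -> obj -> Type ;
  idc : forall X, hom X X ;
  compc : forall X Y Z, hom Y Z -> hom X Y -> hom X Z ;
  comp_idl : forall X Y (f : hom X Y), compc (idc Y) f = f ;
  comp_idr : forall X Y (f : hom X Y), compc f (idc X) = f ;
  comp_assoc : forall X Y Z W (h : hom Z W) (g : hom Y Z) (f : hom X Y),
    compc h (compc g f) = compc (compc h g) f }.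
Arguments hom {c} _ _.
Arguments idc {c} _.
Arguments compc {c X Y Z} _ _.

Record functor (C D : category) := Functor {
  fobj :> C -> D ;
  fmap : forall X Y, hom X Y -> hom (fobj X) (fobj Y) ;
  fmap_id : forall X, fmap (idc X) = idc (fobj X) ;
  fmap_comp : forall X Y Z (g : hom Y Z) (f : hom X Y),
    fmap (compc g f) = compc (fmap g) (fmap f) }.
Arguments fmap {C D} _ {X Y} _.

Definition full (C D : category) (F : functor C D) :=
  forall (X Y : C) (g : hom (F X) (F Y)), exists f : hom X Y, fmap F f = g.

Definition faithful (C D : category) (F : functor C D) :=
  forall (X Y : C) (f g : hom X Y), fmap F f = fmap F g -> f = g.

Record nnreal (R : realType) := NNReal {
  nnval :> R; nnvalP : nnval \is Num.nneg }.

HB.instance Definition _ (R : realType) := [isSub for @nnval R].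
HB.instance Definition _ (R : realType) := [Choice of nnreal R by <:].
HB.instance Definition _ (R : realType) :=
  [SubChoice_isSubComNzSemiRing of nnreal R by <:].
HB.instance Definition _ (R : realType) :=
  GRing.LSemiModule.copy (nnreal R) (nnreal R)^o.

Definition nn (R : realType) (x : R) (x0 : 0 <= x) : nnreal R := @NNReal R x x0.

Lemma nn_ge0 (R : realType) (x : nnreal R) : 0 <= x :> R.
Proof. exact: nnvalP. Qed.

Definition cone_le (P : nmodType) (x y : P) := exists z, y = x + z.

Definition cone_incr (P : nmodType) (u : nat -> P) :=
  forall m n, (m <= n)%N -> cone_le (u m) (u n).

Definition cone_lub (P : nmodType) (u : nat -> P) (x : P) :=
  (forall n, cone_le (u n) x) /\
  (forall y, (forall n, cone_le (u n) y) -> cone_le x y).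

HB.mixin Record isPrecone (R : realType) P & GRing.LSemiModule (nnreal R) P := {
  precone_addIr : forall x x1 x2 : P, x1 + x = x2 + x -> x1 = x2 ;
  precone_addr_eq0 : forall x1 x2 : P, x1 + x2 = 0 -> x1 = 0 }.

#[short(type="preconeType")]
HB.structure Definition Precone (R : realType) :=
  { P of GRing.LSemiModule (nnreal R) P & isPrecone R P }.

HB.mixin Record isCone (R : realType) P & Precone R P := {
  cnorm : P -> nnreal R ;
  cnormZ : forall (a : nnreal R) (x : P), cnorm (a *: x) = a * cnorm x ;
  cnorm_eq0 : forall x : P, cnorm x = 0 -> x = 0 ;
  ler_cnormD : forall x y : P, cnorm (x + y) <= cnorm x + cnorm y :> R ;
  ler_cnormDl : forall x y : P, cnorm x <= cnorm (x + y) :> R ;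
  cone_complete : forall u : nat -> P, cone_incr u ->
    (forall n, cnorm (u n) <= 1 :> R) ->
    exists2 x, cone_lub u x & cnorm x <= 1 :> R }.

#[short(type="coneType")]
HB.structure Definition Cone (R : realType) := { P of Precone R P & isCone R P }.

Section cone_maps.
Context (R : realType) (P Q : coneType R).

Definition cone_ball : set P := [set x | cnorm x <= 1 :> R].

Definition cone_continuous (f : P -> Q) :=
  (forall x y, cone_le x y -> cone_le (f x) (f y)) /\
  (forall (u : nat -> P) (x : P), cone_incr u ->
    (exists M : R, forall n, cnorm (u n) <= M :> R) ->
    cone_lub u x -> cone_lub (f \o u) (f x)).

(* Taken in \bar R: a real supremum would be 0 on an unbounded set. *)
Definition opnorm (f : P -> Q) : \bar R :=
  ereal_sup [set (cnorm (f x) : R)%:E | x in cone_ball].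

Definition lin_continuous : set (P -> Q) :=
  [set f | [/\ scalable f, {morph f : x y / x + y} & cone_continuous f]].

End cone_maps.

Section nnreal_cone.
Context (R : realType).
Local Notation Rp := (nnreal R).

Lemma nnreal_leP (x y : Rp) : cone_le x y <-> x <= y :> R.
Proof.
split=> [[z ->]|xy]; first by rewrite /= lerDl; exact: nn_ge0.
have d0 : 0 <= (y : R) - (x : R) by rewrite subr_ge0.
by exists (nn d0); apply: val_inj => /=; rewrite addrC subrK.
Qed.

Let addIr (x x1 x2 : Rp) : x1 + x = x2 + x -> x1 = x2.
Proof. by move=> /(congr1 (@nnval R)) /= /addIr /val_inj. Qed.

Let addr_eq0 (x1 x2 : Rp) : x1 + x2 = 0 -> x1 = 0.
Proof.
move=> /(congr1 (@nnval R)) /= /eqP.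
by rewrite paddr_eq0 ?nn_ge0 // => /andP[/eqP x10 _]; exact: val_inj.
Qed.

HB.instance Definition _ := isPrecone.Build R Rp addIr addr_eq0.

Let complete (u : nat -> Rp) : cone_incr u ->
  (forall n, u n <= 1 :> R) ->
  exists2 x : Rp, cone_lub u x & x <= 1 :> R.
Proof.
move=> _ u1.
set A := range (fun n => u n : R).
have A0 : A !=set0 by exists (u 0%N : R), 0%N.
have Aub : has_ubound A by exists 1 => _ [n _ <-].
have s0 : 0 <= sup A.
  apply: (le_trans (nn_ge0 (u 0%N))).
  by apply: ub_le_sup => //; exists 0%N.
exists (nn s0); last by apply: ge_sup => // _ [n _ <-].
split=> [n|y uy]; apply/nnreal_leP.
  by apply: ub_le_sup => //; exists n.
by apply: ge_sup => // _ [n _ <-]; apply/nnreal_leP.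
Qed.

HB.instance Definition _ := @isCone.Build R Rp
  (fun x => x) (fun _ _ => erefl) (fun _ h => h)
  (fun _ _ => lexx _) (fun x y => (nnreal_leP x (x + y)).1 (ex_intro _ y erefl))
  complete.

End nnreal_cone.

(* The small full subcategory Ar of measurable spaces, as a family of spaces
   indexed by its objects; it is full, so its morphisms are all the measurable
   functions. The canonical product space is only required to be isomorphic to
   an object. *)
Record arities := Arities {
  ar_obj :> Type ;
  ar_disp : ar_obj -> measure_display ;
  ar_space : forall X : ar_obj, measurableType (ar_disp X) ;
  ar_inhabited : forall X, inhabited (ar_space X) ;
  ar_one : ar_obj ;
  ar_pt : ar_space ar_one ;
  ar_ptP : forall s : ar_space ar_one, s = ar_pt ;
  ar_prod : forall X Y : ar_obj, exists (Z : ar_obj)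
    (f : ar_space Z -> ar_space X * ar_space Y)
    (g : ar_space X * ar_space Y -> ar_space Z),
    [/\ measurable_fun setT f, measurable_fun setT g, cancel f g & cancel g f] }.
Arguments ar_pt {_}.
Coercion ar_space : ar_obj >-> Measurable.type.

HB.mixin Record isMeasurableCone (R : realType) (Ar : arities) P & Cone R P := {
  mtest : forall X : Ar, set (X -> P -> nnreal R) ;
  mtest_dual : forall (X : Ar) m, mtest X m -> forall r, lin_continuous (m r) ;
  mtest_measurable : forall (X : Ar) m (x : P), mtest X m -> cone_ball x ->
    measurable_fun setT (fun r => m r x : R) /\
    forall r, m r x <= 1 :> R ;
  mtest_comp : forall (X Y : Ar) (phi : Y -> X) m,
    measurable_fun setT phi -> mtest X m -> mtest Y (fun s => m (phi s)) ;
  mtest_separates : forall x y : P,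
    (forall m, mtest (ar_one Ar) m -> m ar_pt x = m ar_pt y) -> x = y ;
  (* [opnorm (m ar_pt)] is finite by [mtest_measurable], and [sup set0 = 0]
     covers the cones without nonzero test. *)
  mtest_norm : forall x : P,
    cnorm x = sup [set (m ar_pt x : R) / fine (opnorm (m ar_pt))
      | m in [set m | mtest (ar_one Ar) m /\ m <> fun=> fun=> 0]] :> R }.

#[short(type="measurableConeType")]
HB.structure Definition MeasurableCone (R : realType) (Ar : arities) :=
  { P of Cone R P & isMeasurableCone R Ar P }.

Section paths.
Context (R : realType) (Ar : arities) (C : measurableConeType R Ar).

Definition is_path (X : Ar) (gamma : X -> C) :=
  (exists M : R, forall r, cnorm (gamma r) <= M :> R) /\
  (forall (Y : Ar) m, mtest Y m ->
    measurable_fun setT (fun sr : Y * X => m sr.1 (gamma sr.2) : R)).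

Definition is_integral (X : Ar) (gamma : X -> C)
    (mu : {finite_measure set X -> \bar R}) (x : C) :=
  forall m, mtest (ar_one Ar) m ->
    ((m ar_pt x : R)%:E =
     \int[mu]_r (m ar_pt (gamma r) : R)%:E)%E.

End paths.

HB.mixin Record isIntegrableCone (R : realType) (Ar : arities) P
    & MeasurableCone R Ar P := {
  integral_exists : forall (X : Ar) (gamma : X -> P)
    (mu : {finite_measure set X -> \bar R}), is_path gamma ->
    exists x, is_integral gamma mu x }.

#[short(type="integrableConeType")]
HB.structure Definition IntegrableCone (R : realType) (Ar : arities) :=
  { P of MeasurableCone R Ar P & isIntegrableCone R Ar P }.

(* A {measure set T -> \bar R} also carries arbitrary values on the
   non-measurable sets. A measure in the mathematical sense is represented by
   the one that vanishes there, so that Leibniz equality of measures is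
   agreement on the measurable sets. *)
Definition normalized d (T : measurableType d) (R : realType)
    (mu : set T -> \bar R) := forall U, ~ measurable U -> mu U = 0%E.

Record fmeas (R : realType) d (T : measurableType d) := FMeas {
  fmeas_mu :> {finite_measure set T -> \bar R} ;
  fmeas_norm : normalized fmeas_mu }.

Section finite_normalized.
Context d (T : measurableType d) (R : realType).
Variables (mu : {measure set T -> \bar R}) (mufin : (mu setT < +oo)%E)
  (munorm : normalized mu).

Definition fin_measure & (mu setT < +oo)%E : set T -> \bar R := mu.
Local Notation nu := (fin_measure mufin).

HB.instance Definition _ := Measure.on nu.

Let nu_fin : fin_num_fun nu.
Proof. exact: lty_fin_num_fun. Qed.

HB.instance Definition _ := @Measure_isFinite.Build _ T R nu nu_fin.

Definition mk_fmeas : fmeas R T := @FMeas R d T nu munorm.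

End finite_normalized.

Section fmeas_theory.
Context (R : realType) d (T : measurableType d).
Implicit Types (m : fmeas R T) (U : set T).
Local Open Scope ereal_scope.

Lemma finite_measure_ext (m1 m2 : {finite_measure set T -> \bar R}) :
  m1 = m2 :> (set T -> \bar R) -> m1 = m2.
Proof.
case: m1 m2 => m1 c1 [m2 c2] /= e; subst m2; congr (FiniteMeasure.Pack _).
case: c1 c2 => [[a1 b1] [e1] [f1] [g1] [h1]] [[a2 b2] [e2] [f2] [g2] [h2]].
rewrite (Prop_irrelevance a2 a1) in e2 *.
rewrite (Prop_irrelevance b2 b1) (Prop_irrelevance e2 e1).
by rewrite (Prop_irrelevance f2 f1) (Prop_irrelevance g2 g1) (Prop_irrelevance h2 h1).
Qed.

Lemma fmeas_ext m1 m2 : (forall U, measurable U -> m1 U = m2 U) -> m1 = m2.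
Proof.
move=> e; have {}e : m1 = m2 :> {finite_measure set T -> \bar R}.
  apply: finite_measure_ext; apply/funext => U.
  have [mU|mU] := pselect (measurable U); first exact: e.
  by rewrite !fmeas_norm.
case: m1 m2 e => m1 n1 [m2 n2] /= e; subst m2.
by congr FMeas; exact: Prop_irrelevance.
Qed.

Lemma fmeas0 m U : ~ measurable U -> m U = 0.
Proof. by move=> mU; rewrite fmeas_norm. Qed.

Lemma fmeas_fin m U : m U \is a fin_num.
Proof.
have [mU|mU] := pselect (measurable U); first exact: fin_num_measure.
by rewrite fmeas_norm.
Qed.

Lemma fmeas_ltT m : m setT < +oo.
Proof. by rewrite ltey_eq fmeas_fin. Qed.

Lemma fmeas_fine m U : (fine (m U))%:E = m U.
Proof. by rewrite fineK // fmeas_fin. Qed.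

Lemma fmeas_fine_ge0 m U : (0 <= fine (m U))%R.
Proof. exact: fine_ge0. Qed.

Definition fmeas_val m U : nnreal R := nn (fmeas_fine_ge0 m U).

Fact fzero_fin : @mzero d T R setT < +oo. Proof. exact: ltry. Qed.

Definition fzero : fmeas R T := @mk_fmeas d T R mzero fzero_fin (fun _ _ => erefl).

Let maddE m1 m2 U : measure_add m1 m2 U = m1 U + m2 U.
Proof. exact: measure_addE. Qed.

Fact fadd_fin m1 m2 : measure_add m1 m2 setT < +oo.
Proof. by rewrite maddE lte_add_pinfty // fmeas_ltT. Qed.

Fact fadd_norm m1 m2 : normalized (measure_add m1 m2).
Proof. by move=> U mU; rewrite maddE !fmeas0 // adde0. Qed.

Definition fadd m1 m2 : fmeas R T := mk_fmeas (fadd_fin m1 m2) (@fadd_norm m1 m2).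

Lemma faddE m1 m2 U : fadd m1 m2 U = m1 U + m2 U.
Proof. exact: maddE. Qed.

Definition nnng (a : nnreal R) : {nonneg R} := NngNum (nn_ge0 a).

Let mscaleE (a : nnreal R) m U : mscale (nnng a) m U = (a : R)%:E * m U.
Proof. by []. Qed.

Fact fscale_fin (a : nnreal R) m : mscale (nnng a) m setT < +oo.
Proof. by rewrite ltey_eq mscaleE fin_numM // fmeas_fin. Qed.

Fact fscale_norm (a : nnreal R) m : normalized (mscale (nnng a) m).
Proof. by move=> U mU; rewrite mscaleE fmeas0 // mule0. Qed.

Definition fscale a m : fmeas R T := mk_fmeas (fscale_fin a m) (@fscale_norm a m).

Lemma fscaleE a m U : fscale a m U = (a : R)%:E * m U.
Proof. by []. Qed.

HB.instance Definition _ := gen_eqMixin (fmeas R T).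
HB.instance Definition _ := gen_choiceMixin (fmeas R T).

Let addA : associative fadd.
Proof. by move=> a b c; apply: fmeas_ext => U _; rewrite !faddE addeA. Qed.
Let addC : commutative fadd.
Proof. by move=> a b; apply: fmeas_ext => U _; rewrite !faddE addeC. Qed.
Let add0 : left_id fzero fadd.
Proof. by move=> a; apply: fmeas_ext => U _; rewrite !faddE add0e. Qed.

HB.instance Definition _ := GRing.isNmodule.Build (fmeas R T) addA addC add0.

Let scaleA (a b : nnreal R) m : fscale a (fscale b m) = fscale (a * b)%R m.
Proof. by apply: fmeas_ext => U _; rewrite !fscaleE EFinM muleA. Qed.
Let scale0 m : fscale 0%R m = 0%R.
Proof. by apply: fmeas_ext => U _; rewrite !fscaleE mul0e. Qed.
Let scale1 : left_id 1%R fscale.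
Proof. by move=> m; apply: fmeas_ext => U _; rewrite !fscaleE mul1e. Qed.
Let scaleDr : right_distributive fscale +%R.
Proof.
move=> a m1 m2; apply: fmeas_ext => U _.
by rewrite !faddE !fscaleE faddE muleDr // fin_num_adde_defl // fmeas_fin.
Qed.
Let scaleDl m : {morph fscale^~ m : a b / (a + b)%R}.
Proof.
move=> a b; apply: fmeas_ext => U _.
by rewrite !faddE !fscaleE EFinD ge0_muleDl // lee_fin nn_ge0.
Qed.

HB.instance Definition _ := GRing.Nmodule_isLSemiModule.Build (nnreal R) (fmeas R T)
  scaleA scale0 scale1 scaleDr scaleDl.

Lemma fmeasD m1 m2 U : (m1 + m2)%R U = m1 U + m2 U.
Proof. exact: faddE. Qed.

Lemma fmeasZ (a : nnreal R) m U : (a *: m)%R U = (a : R)%:E * m U.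
Proof. by []. Qed.

Let addIr m m1 m2 : (m1 + m = m2 + m)%R -> m1 = m2.
Proof.
move=> e; apply: fmeas_ext => U _.
have : (m1 + m)%R U = (m2 + m)%R U by rewrite e.
rewrite !fmeasD => /(congr1 (fun c => c - m U)).
by rewrite !addeK // fmeas_fin.
Qed.

Let addr_eq0 m1 m2 : (m1 + m2 = 0)%R -> m1 = 0%R.
Proof.
move=> e; apply: fmeas_ext => U _.
have : (m1 + m2)%R U = 0 by rewrite e.
by rewrite fmeasD => /eqP; rewrite padde_eq0 // => /andP[/eqP].
Qed.

HB.instance Definition _ := isPrecone.Build R (fmeas R T) addIr addr_eq0.

Section difference.
Variables (m1 m2 : fmeas R T).
Hypothesis le12 : forall U, measurable U -> m1 U <= m2 U.

Let dif := cadd (charge_of_finite_measure m2) (copp (charge_of_finite_measure m1)).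

Let difE U : dif U = m2 U - m1 U. Proof. by []. Qed.

Let dif_ge0 U : 0 <= dif U.
Proof.
have [mU|mU] := pselect (measurable U).
  by rewrite difE sube_ge0 ?le12 // fmeas_fin.
by rewrite difE !fmeas0 // sube0.
Qed.

Let dif_fin : measure_of_charge dif dif_ge0 setT < +oo.
Proof. by rewrite ltey_eq /measure_of_charge difE fin_numB !fmeas_fin. Qed.

Let dif_norm : normalized (measure_of_charge dif dif_ge0).
Proof. by move=> U mU; rewrite /measure_of_charge difE !fmeas0 // sube0. Qed.

Lemma fmeas_le_of : cone_le m1 m2.
Proof.
exists (mk_fmeas dif_fin dif_norm); apply: fmeas_ext => U _.
rewrite fmeasD.
have -> : mk_fmeas dif_fin dif_norm U = m2 U - m1 U by [].
by rewrite addeC subeK // fmeas_fin.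
Qed.

End difference.

Lemma fmeas_leP m1 m2 : cone_le m1 m2 <-> forall U, measurable U -> m1 U <= m2 U.
Proof.
split=> [[z -> U mU]|]; last exact: fmeas_le_of.
by rewrite fmeasD leeDl.
Qed.

Lemma fmeas_increments (u : nat -> fmeas R T) : cone_incr u ->
  exists z : nat -> fmeas R T,
    forall n U, \sum_(0 <= k < n.+1) z k U = u n U.
Proof.
move=> incr.
have /choice[z zE] : forall n, exists z, u n.+1 = (u n + z)%R.
  by move=> n; exact: incr.
exists (fun n => if n is k.+1 then z k else u 0%N) => n U.
elim: n => [|n ih]; first by rewrite big_nat1.
by rewrite big_nat_recr //= ih zE fmeasD.
Qed.

Lemma nneseries_le_sup (z : nat -> \bar R) (c : \bar R) : (forall k, 0 <= z k) ->
  (forall n, \sum_(0 <= k < n.+1) z k <= c) -> \sum_(0 <= k <oo) z k <= c.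
Proof.
move=> z0 zc; apply: lime_le; first exact: is_cvg_nneseries.
apply: nearW => -[|n]; last exact: zc.
rewrite big_geq //; apply: le_trans (zc 0%N).
by rewrite big_nat1.
Qed.

Lemma nneseries_ge_sum (z : nat -> \bar R) n : (forall k, 0 <= z k) ->
  \sum_(0 <= k < n.+1) z k <= \sum_(0 <= k <oo) z k.
Proof. by move=> z0; apply: nneseries_lim_ge. Qed.

Lemma fmeas_lub_series (u z : nat -> fmeas R T) (c : R) :
  (forall n U, \sum_(0 <= k < n.+1) z k U = u n U) ->
  (forall n, u n setT <= c%:E) ->
  exists2 x, cone_lub u x & forall U, x U = \sum_(0 <= k <oo) z k U.
Proof.
move=> zE uc; pose s : {measure set T -> \bar R} := mseries z 0.
have sT : s setT < +oo.
  apply: (@le_lt_trans _ _ c%:E); last exact: ltry.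
  by apply: nneseries_le_sup => // n; rewrite zE.
have sN : normalized s.
  move=> U mU; rewrite /s /= /mseries eseries0 // => k _ _.
  exact: (@fmeas0 (z k)).
exists (mk_fmeas sT sN) => //; split=> [n|y uy]; apply/fmeas_leP => U mU.
  by rewrite -zE; exact: nneseries_ge_sum.
apply: nneseries_le_sup => // n; rewrite zE.
by move/fmeas_leP: (uy n); exact.
Qed.

Lemma cone_le_anti m1 m2 : cone_le m1 m2 -> cone_le m2 m1 -> m1 = m2.
Proof.
move=> /fmeas_leP a /fmeas_leP b; apply: fmeas_ext => U mU.
by apply/eqP; rewrite eq_le a // b.
Qed.

Lemma fmeas_lubE (u z : nat -> fmeas R T) x :
  (forall n U, \sum_(0 <= k < n.+1) z k U = u n U) ->
  cone_lub u x -> forall U, x U = \sum_(0 <= k <oo) z k U.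
Proof.
move=> zE xlub.
have [|y ylub yE] := @fmeas_lub_series u z (fine (x setT)) zE.
  by move=> n; rewrite fmeas_fine; move/fmeas_leP: (xlub.1 n); exact.
suff -> : x = y by [].
by apply: cone_le_anti; [apply: xlub.2 ylub.1|apply: ylub.2 xlub.1].
Qed.

Lemma fmeas_integral_lub (u : nat -> fmeas R T) (x : fmeas R T) (g : T -> \bar R) (c : \bar R) :
  (forall t, 0 <= g t) -> measurable_fun setT g ->
  cone_incr u -> cone_lub u x ->
  (forall n, \int[u n]_t g t <= c) -> \int[x]_t g t <= c.
Proof.
move=> g0 mg incr xlub uc; have [z zE] := fmeas_increments incr.
have xE := fmeas_lubE zE xlub.
rewrite (@eq_measure_integral _ _ _ _ (mseries z 0)); last by move=> U _ _; exact: xE.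
rewrite ge0_integral_measure_series //.
apply: nneseries_le_sup => [k|n]; first exact: integral_ge0.
rewrite big_mkord -(@ge0_integral_measure_sum _ _ _ z) //.
rewrite (@eq_measure_integral _ _ _ _ (u n)); first exact: uc.
move=> U _ _; transitivity (\sum_(0 <= k < n.+1) z k U); last exact: zE.
by rewrite big_mkord.
Qed.

Let normZ (a : nnreal R) m : fmeas_val (a *: m) setT = (a * fmeas_val m setT)%R.
Proof. by apply: val_inj; rewrite /= mscaleE fineM // fmeas_fin. Qed.

Let norm_eq0 m : fmeas_val m setT = 0%R -> m = 0%R.
Proof.
move=> /(congr1 (@nnval R)) /= m0; apply: fmeas_ext => U mU.
have mT : m setT = 0 by rewrite -fmeas_fine m0.
by apply/eqP; rewrite -measure_le0 -mT le_measure // inE.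
Qed.

Let normD m1 m2 :
  (fmeas_val (m1 + m2)%R setT <= fmeas_val m1 setT + fmeas_val m2 setT :> R)%R.
Proof.
rewrite -[leLHS]/(fine ((m1 + m2)%R setT)) fmeasD.
by rewrite fineD // fmeas_fin.
Qed.

Let normDl m1 m2 : (fmeas_val m1 setT <= fmeas_val (m1 + m2)%R setT :> R)%R.
Proof.
rewrite -[leRHS]/(fine ((m1 + m2)%R setT)) fmeasD fineD ?fmeas_fin //.
by rewrite lerDl; exact: fmeas_fine_ge0.
Qed.

Let complete (u : nat -> fmeas R T) : cone_incr u ->
  (forall n, fmeas_val (u n) setT <= 1 :> R)%R ->
  exists2 x, cone_lub u x & (fmeas_val x setT <= 1 :> R)%R.
Proof.
move=> incr u1; have [z zE] := fmeas_increments incr.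
have u1' n : u n setT <= 1%:E by rewrite -fmeas_fine lee_fin; exact: u1.
have [x xlub xE] := fmeas_lub_series zE u1'.
exists x => //=; rewrite -lee_fin fmeas_fine xE.
by apply: nneseries_le_sup => // n; rewrite zE.
Qed.

HB.instance Definition _ := isCone.Build R (fmeas R T)
  normZ norm_eq0 normD normDl complete.

Lemma cnorm_fmeasE m : (cnorm m : R) = fine (m setT).
Proof. by []. Qed.

End fmeas_theory.

Section trim.
Context d (T : measurableType d) (R : realType).
Variable mu : {measure set T -> \bar R}.
Local Open Scope ereal_scope.

Definition trim (U : set T) : \bar R := if `[< measurable U >] then mu U else 0.

Lemma trimE U : measurable U -> trim U = mu U.
Proof. by move=> mU; rewrite /trim asboolT. Qed.

Lemma trim_norm : normalized trim.
Proof. by move=> U mU; rewrite /trim asboolF. Qed.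

Let trim0 : trim set0 = 0.
Proof. by rewrite trimE // measure0. Qed.

Let trim_ge0 U : 0 <= trim U.
Proof. by rewrite /trim; case: ifP. Qed.

Let trim_sigma : semi_sigma_additive trim.
Proof.
move=> F mF tF mU; rewrite trimE //.
rewrite (_ : (fun n => _) = (fun n => \sum_(0 <= i < n) mu (F i))).
  exact: measure_semi_sigma_additive.
by apply/funext => n; apply: eq_bigr => i _; rewrite trimE.
Qed.

HB.instance Definition _ := isMeasure.Build d T R trim trim0 trim_ge0 trim_sigma.

End trim.

Section kernel_integral.
Context d d' (T : measurableType d) (T' : measurableType d') (R : realType).
Variables (mu : {measure set T -> \bar R}) (k : T -> {measure set T' -> \bar R}).
Hypothesis mufin : (mu setT < +oo)%E.
Hypothesis mk : forall U, measurable U -> measurable_fun [set: T] (k ^~ U).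
Hypothesis bk : measure_fam_uub k.
Local Open Scope ereal_scope.

(* [kint] is the measure U |-> \int[mu]_y k y U, see [kintE]. It is built as a
   kernel composite, with a dummy parameter in unit, because this is the form
   for which integration against a composite is available. *)
Definition kcst (_ : mu setT < +oo) (_ : unit) := mu.
Local Notation l := (kcst mufin).

Let l_meas U : measurable U -> measurable_fun [set: unit] (l ^~ U).
Proof. by move=> _; exact: measurable_cst. Qed.

HB.instance Definition _ := @isKernel.Build _ _ unit T R l l_meas.

Let l_uub : measure_fam_uub l.
Proof.
exists (fine (mu setT) + 1)%R => ?; rewrite EFinD fineK ?ge0_fin_numE //.
by rewrite lteDl ?lte_fin // ge0_fin_numE.
Qed.

HB.instance Definition _ := @Kernel_isFinite.Build _ _ unit T R l l_uub.

Definition ksnd (_ : forall U, measurable U -> measurable_fun [set: T] (k ^~ U))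
  (_ : measure_fam_uub k) (p : unit * T) := k p.2.
Local Notation ks := (ksnd mk bk).

Let ks_meas U : measurable U -> measurable_fun [set: unit * T] (ks ^~ U).
Proof.
by move=> mU; apply: (measurableT_comp (mk mU)); exact: measurable_snd.
Qed.

HB.instance Definition _ := @isKernel.Build _ _ _ T' R ks ks_meas.

Let ks_uub : measure_fam_uub ks.
Proof. by have [r kr] := bk; exists r => -[]. Qed.

HB.instance Definition _ := @Kernel_isFinite.Build _ _ _ T' R ks ks_uub.

Definition kint : {measure set T' -> \bar R} := mkcomp l ks tt.

Lemma kintE U : kint U = \int[mu]_y k y U.
Proof. by []. Qed.

Lemma integral_kint f : (forall z, 0 <= f z) -> measurable_fun [set: T'] f ->
  \int[kint]_z f z = \int[mu]_y \int[k y]_z f z.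
Proof. exact: integral_kcomp. Qed.

Lemma kint_fin : kint setT < +oo.
Proof.
have [r kr] := bk; rewrite kintE.
apply: (@le_lt_trans _ _ (\int[mu]__ (cst r%:E) tt)).
  by apply: ge0_le_integral => // [|y _]; [exact: mk|exact: ltW].
by rewrite integral_cst // lte_mul_pinfty //; apply: le_trans (ltW (kr point)).
Qed.

Lemma kint_norm : (forall y, normalized (k y)) -> normalized kint.
Proof.
by move=> kn U mU; rewrite kintE integral0_eq // => y _; rewrite kn.
Qed.

End kernel_integral.

Section fmeas_measurable_cone.
Context (R : realType) (Ar : arities) d (T : measurableType d).
Local Open Scope ereal_scope.

Definition fmeas_test (Y : Ar) : set (Y -> fmeas R T -> nnreal R) :=
  [set m | exists2 U, measurable U & m = fun _ mu => fmeas_val mu U].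
Arguments fmeas_test : clear implicits.

Lemma trim_diracE (r : T) U : measurable U ->
  trim (\d_r : {measure set T -> \bar R}) U = (\1_U r)%:E.
Proof. by move=> mU; rewrite trimE. Qed.

Fact fdirac_fin (r : T) : trim (\d_r : {measure set T -> \bar R}) setT < +oo.
Proof. by rewrite trim_diracE // ltry. Qed.

Definition fdirac (r : T) : fmeas R T :=
  mk_fmeas (fdirac_fin r) (@trim_norm _ _ _ _).

Lemma integral_fmeas_indic (mu : fmeas R T) U : measurable U ->
  \int[mu]_t (\1_U t)%:E = mu U.
Proof. by move=> mU; rewrite integral_indic // setIT. Qed.

Let test_lin (U : set T) : measurable U ->
  lin_continuous (fun mu : fmeas R T => fmeas_val mu U).
Proof.
move=> mU; split=> [a mu|mu nu|].
- by apply: val_inj; rewrite /= -[RHS]/(fine (a : R)%:E * fine (mu U))%R -fineM // fmeas_fin.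
- apply: val_inj; rewrite -[LHS]/(fine ((mu + nu)%R U)) fmeasD.
  by rewrite fineD // fmeas_fin.
split=> [mu nu /fmeas_leP mn|u x incr _ xlub].
  by apply/nnreal_leP; rewrite -lee_fin /= !fmeas_fine; exact: mn.
split=> [n|y uy]; apply/nnreal_leP; rewrite -lee_fin /= fmeas_fine.
  by rewrite fmeas_fine; move/fmeas_leP: (xlub.1 n); exact.
rewrite -integral_fmeas_indic //.
apply: (fmeas_integral_lub _ _ incr xlub) => [t|//|n].
- by rewrite lee_fin.
- by apply/measurable_EFinP; exact: measurable_indic.
- rewrite integral_fmeas_indic // -fmeas_fine lee_fin.
  by have /nnreal_leP := uy n.
Qed.

Let mtest_dual (X : Ar) m : fmeas_test X m -> forall r, lin_continuous (m r).
Proof. by move=> [U mU ->] r; exact: test_lin. Qed.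

Let le_setT (mu : fmeas R T) U : measurable U -> (fine (mu U) <= fine (mu setT))%R.
Proof.
by move=> mU; rewrite -lee_fin !fmeas_fine le_measure // inE.
Qed.

Let mtest_measurable (X : Ar) m (x : fmeas R T) : fmeas_test X m -> cone_ball x ->
  measurable_fun [set: X] (fun r => m r x : R) /\ (forall r, m r x <= 1 :> R)%R.
Proof.
move=> [U mU ->] x1; split; first exact: measurable_cst.
by move=> r; apply: le_trans x1; exact: le_setT.
Qed.

Let mtest_comp (X Y : Ar) (phi : Y -> X) m :
  measurable_fun [set: Y] phi -> fmeas_test X m -> fmeas_test Y (fun s => m (phi s)).
Proof. by move=> _ [U mU ->]; exists U. Qed.

Let mtest_separates (x y : fmeas R T) :
  (forall m, fmeas_test (ar_one Ar) m -> m ar_pt x = m ar_pt y) -> x = y.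
Proof.
move=> xy; apply: fmeas_ext => U mU; rewrite -(fmeas_fine x) -(fmeas_fine y).
congr EFin; have /(congr1 (@nnval R)) := xy (fun _ mu => fmeas_val mu U) (ex_intro2 _ _ U mU erefl).
by [].
Qed.

Let opnorm_test (U : set T) : measurable U -> U !=set0 ->
  opnorm (fun mu : fmeas R T => fmeas_val mu U) = 1.
Proof.
move=> mU [r Ur]; apply/eqP; rewrite eq_le; apply/andP; split.
  apply: ge_ereal_sup => _ [mu mu1 <-]; rewrite lee_fin.
  by apply: le_trans mu1; exact: le_setT.
apply: ereal_sup_ubound; exists (fdirac r) => /=.
  by rewrite /cone_ball /= trim_diracE //= indicT.
by rewrite /= trim_diracE //= indicE mem_set.
Qed.

Let mtest_norm (x : fmeas R T) :
  cnorm x = sup [set (m ar_pt x : R) / fine (opnorm (m ar_pt))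
    | m in [set m | fmeas_test (ar_one Ar) m /\ m <> fun=> fun=> 0]]%R :> R.
Proof.
set S := (X in sup X).
have test_ne (U : set T) (m : ar_one Ar -> fmeas R T -> nnreal R) :
    measurable U -> m = (fun _ mu => fmeas_val mu U) ->
    m <> (fun=> fun=> 0%R) -> opnorm (m ar_pt) = 1.
  move=> mU -> m0; apply: (opnorm_test mU).
  apply: contra_notP m0 => /nonemptyPn ->.
  by apply/funext => s; apply/funext => mu; apply: val_inj; rewrite /= measure0.
have Sle : ubound S (cnorm x : R).
  move=> _ [m [[U mU mE] m0] <-]; rewrite (test_ne U) // mE /= divr1.
  exact: le_setT.
have [x0|x0] := eqVneq (cnorm x : R) 0%R.
  have S0 : S `<=` [set 0%R].
    move=> _ [m [[U mU mE] m0] <-]; rewrite (test_ne U) // mE /= divr1.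
    by apply/eqP; rewrite eq_le fmeas_fine_ge0 -{1}x0 le_setT.
  have [->|/set0P Sn] := eqVneq S set0; first by rewrite sup0.
  rewrite x0 (_ : S = [set 0%R]) ?sup1 //.
  by apply/seteqP; split=> // _ ->; have [s Ss] := Sn; rewrite -(S0 s Ss).
pose tT : ar_one Ar -> fmeas R T -> nnreal R := fun _ mu => fmeas_val mu setT.
have tT0 : tT <> (fun=> fun=> 0%R).
  move=> e; case/eqP: x0.
  exact: (congr1 (fun m : ar_one Ar -> fmeas R T -> nnreal R => nnval (m ar_pt x)) e).
have Sx : S (cnorm x : R).
  exists tT; first by split=> //; exists setT.
  by rewrite (test_ne setT) // divr1.
apply/eqP; rewrite eq_le ub_le_sup //=; last by exists (cnorm x : R).
by apply: ge_sup => //; exists (cnorm x : R).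
Qed.

HB.instance Definition _ := isMeasurableCone.Build R Ar (fmeas R T)
  mtest_dual mtest_measurable mtest_comp mtest_separates mtest_norm.

Lemma fmeas_pathP (X : Ar) (gamma : X -> fmeas R T) :
  is_path (Ar := Ar) gamma <->
  measure_fam_uub gamma /\
  forall U, measurable U -> measurable_fun [set: X] (fun r => gamma r U).
Proof.
split=> [[[M gM] mg]|[[M gM] mg]]; split.
- exists (M + 1)%R => r; rewrite -[X in X < _]/(gamma r setT) -fmeas_fine lte_fin.
  by rewrite (le_lt_trans (gM r)) // ltrDl.
- move=> U mU.
  have := mg (ar_one Ar) (fun _ mu => fmeas_val mu U) (ex_intro2 _ _ U mU erefl).
  move=> /measurable_EFinP /= h.
  rewrite (_ : (fun r => _) =
    (fun sr : ar_one Ar * X => (fine (gamma sr.2 U))%:E) \o pair ar_pt).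
    by apply: measurableT_comp h _; exact: pair1_measurable.
  by apply/funext => r /=; rewrite fmeas_fine.
- exists M => r; rewrite -lee_fin cnorm_fmeasE fmeas_fine.
  exact: ltW (gM r).
- move=> Y m [U mU ->]; apply/measurable_EFinP => /=.
  rewrite (_ : EFin \o _ = (fun r => gamma r U) \o snd).
    by apply: measurableT_comp (mg U mU) _; exact: measurable_snd.
  by apply/funext => r /=; rewrite fmeas_fine.
Qed.

Lemma fmeas_integralP (X : Ar) (gamma : X -> fmeas R T)
    (mu : {finite_measure set X -> \bar R}) (x : fmeas R T) :
  is_integral (Ar := Ar) gamma mu x <->
  forall U, measurable U -> x U = \int[mu]_r gamma r U.
Proof.
split=> [xint U mU|xint m [U mU ->]] /=.
  have := xint (fun _ mu => fmeas_val mu U) (ex_intro2 _ _ U mU erefl).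
  rewrite /= fmeas_fine => ->; apply: eq_integral => r _; exact: fmeas_fine.
rewrite fmeas_fine xint //; apply: eq_integral => r _.
by rewrite fmeas_fine.
Qed.

Lemma finite_measure_ltT d' (X : measurableType d')
  (mu : {finite_measure set X -> \bar R}) : mu setT < +oo.
Proof. by rewrite ltey_eq fin_num_measure. Qed.

Let integral_exists (X : Ar) (gamma : X -> fmeas R T)
    (mu : {finite_measure set X -> \bar R}) :
  is_path (Ar := Ar) gamma -> exists x, is_integral (Ar := Ar) gamma mu x.
Proof.
move=> /fmeas_pathP[bg mg].
exists (mk_fmeas (kint_fin (finite_measure_ltT mu) mg bg)
  (kint_norm (finite_measure_ltT mu) mg bg (fun r => @fmeas_norm _ _ _ (gamma r)))).
by apply/fmeas_integralP.
Qed.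

HB.instance Definition _ :=
  isIntegrableCone.Build R Ar (fmeas R T) integral_exists.

End fmeas_measurable_cone.

Section icones.
Context (R : realType) (Ar : arities).

Definition icone_morphism (C D : integrableConeType R Ar) (f : C -> D) :=
  [/\ lin_continuous f, (opnorm f <= 1)%E,
      forall (X : Ar) (gamma : X -> C), is_path gamma -> is_path (f \o gamma) &
      forall (X : Ar) (gamma : X -> C) (mu : {finite_measure set X -> \bar R}) x,
        is_path gamma -> is_integral gamma mu x ->
        is_integral (f \o gamma) mu (f x)].

Record icone_hom (C D : integrableConeType R Ar) := IConeHom {
  icone_fun :> C -> D ;
  icone_funP : icone_morphism icone_fun }.

Lemma icone_hom_ext (C D : integrableConeType R Ar) (f g : icone_hom C D) :
  (forall x, f x = g x) -> f = g.
Proof.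
case: f g => f fP [g gP] /= fg; have {}fg : f = g by exact/funext.
by subst g; congr IConeHom; exact: Prop_irrelevance.
Qed.

Lemma opnorm_le1P (C D : coneType R) (f : C -> D) :
  (opnorm f <= 1)%E <-> forall x, cone_ball x -> cone_ball (f x).
Proof.
split=> [f1 x x1|f1].
  rewrite /cone_ball /= -lee_fin; apply: le_trans f1.
  by apply: ereal_sup_ubound; exists x.
by apply: ge_ereal_sup => _ [x x1 <-]; rewrite lee_fin; exact: f1.
Qed.

Lemma lin_bounded (C D : coneType R) (f : C -> D) (M : R) (x : C) :
  scalable f -> (opnorm f <= 1)%E -> 0 < M ->
  cnorm x <= M :> R -> cnorm (f x) <= M :> R.
Proof.
move=> fZ /opnorm_le1P f1 M0 xM.
have M0' : 0 <= M by exact: ltW.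
have Mi0 : 0 <= M^-1 by rewrite invr_ge0.
pose c := nn M0'; pose ci := nn Mi0.
have cci : c * ci = 1 by apply: val_inj; rewrite /= divff // gt_eqF.
have -> : x = c *: (ci *: x) by rewrite scalerA cci scale1r.
rewrite fZ cnormZ /= -[leRHS]mulr1 ler_wpM2l // f1 //.
by rewrite /cone_ball /= cnormZ /= mulrC ler_pdivrMr // mul1r.
Qed.

Fact icone_id_subproof (C : integrableConeType R Ar) : icone_morphism (@id C).
Proof.
split=> //; last by apply/opnorm_le1P.
Qed.

Definition icone_id C := IConeHom (icone_id_subproof C).

Fact icone_comp_subproof (C D E : integrableConeType R Ar)
  (g : icone_hom D E) (f : icone_hom C D) : icone_morphism (g \o f).
Proof.
case: f g => f [[fZ fD [fm fc]] f1 fp fi] [g [[gZ gD [gm gc]] g1 gp gi]] /=.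
split.
- split=> [a x|x y|] /=; first by rewrite fZ gZ.
    by rewrite fD gD.
  split=> [x y xy|u x incr [M uM] xlub]; first exact/gm/fm.
  apply: (gc (f \o u)).
  + by move=> m n mn; apply/fm/incr.
  + exists (Num.max M 1) => n; apply: lin_bounded => //.
      by rewrite lt_max ltr01 orbT.
    by rewrite le_max uM.
  + by apply: fc => //; exists M.
- move/opnorm_le1P: f1 => f1; move/opnorm_le1P: g1 => g1.
  by apply/opnorm_le1P => x x1; exact/g1/f1.
- by move=> X gamma gaP; exact/(gp _ (f \o gamma))/fp.
- by move=> X gamma mu x gaP xi; apply: (gi _ (f \o gamma)); [exact: fp|exact: fi].
Qed.

Definition icone_comp C D E (g : icone_hom D E) (f : icone_hom C D) :=
  IConeHom (icone_comp_subproof g f).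

Let icone_idl C D (f : icone_hom C D) : icone_comp (icone_id D) f = f.
Proof. exact: icone_hom_ext. Qed.

Let icone_idr C D (f : icone_hom C D) : icone_comp f (icone_id C) = f.
Proof. exact: icone_hom_ext. Qed.

Let icone_compA B C D E (h : icone_hom D E) (g : icone_hom C D) (f : icone_hom B C) :
  icone_comp h (icone_comp g f) = icone_comp (icone_comp h g) f.
Proof. exact: icone_hom_ext. Qed.

Definition ICones : category := {|
  obj := integrableConeType R Ar ;
  hom := icone_hom ;
  idc := icone_id ;
  compc := icone_comp ;
  comp_idl := icone_idl ;
  comp_idr := icone_idr ;
  comp_assoc := icone_compA |}.

End icones.

Section skern.
Context (R : realType) (Ar : arities).
Local Open Scope ereal_scope.

(* As for [fmeas], kernels are taken to vanish on the non-measurable sets. This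
   is preserved by [kcomp_noparam], but Dirac measures have to be trimmed. *)
Record skern_hom (X Y : Ar) := SKernHom {
  skern_fun :> R.-spker X ~> Y ;
  skern_norm : forall r, normalized (skern_fun r) }.

Lemma spker_ext (X Y : Ar) (k1 k2 : R.-spker X ~> Y) :
  (forall r U, k1 r U = k2 r U) -> k1 = k2.
Proof.
case: k1 k2 => k1 c1 [k2 c2] /= e.
have {}e : k1 = k2.
  by apply/funext => r; apply/eq_measure; apply/funext => U; exact: e.
subst k2; congr (SubProbabilityKernel.Pack _).
case: c1 c2 => [[a1] [b1] [e1] [f1] [g1]] [[a2] [b2] [e2] [f2] [g2]].
rewrite (Prop_irrelevance a2 a1) (Prop_irrelevance b2 b1) (Prop_irrelevance e2 e1).
by rewrite (Prop_irrelevance f2 f1) (Prop_irrelevance g2 g1).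
Qed.

Lemma skern_ext (X Y : Ar) (k1 k2 : skern_hom X Y) :
  (forall r U, measurable U -> k1 r U = k2 r U) -> k1 = k2.
Proof.
move=> e; have {}e : k1 = k2 :> (R.-spker X ~> Y).
  apply: spker_ext => r U.
  have [mU|mU] := pselect (measurable U); first exact: e.
  by rewrite !skern_norm.
case: k1 k2 e => k1 n1 [k2 n2] /= e; subst k2.
by congr SKernHom; exact: Prop_irrelevance.
Qed.

Section identity.
Variable X : Ar.

Definition skern_dirac (r : X) : {measure set X -> \bar R} :=
  trim (\d_r : {measure set X -> \bar R}).

Let dirac_meas U : measurable U -> measurable_fun [set: X] (skern_dirac ^~ U).
Proof.
move=> mU; rewrite (_ : (fun _ => _) = (fun r => (\1_U r)%:E)).
  by apply/measurable_EFinP; exact: measurable_indic.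
by apply/funext => r; exact: trim_diracE.
Qed.

HB.instance Definition _ := @isKernel.Build _ _ X X R skern_dirac dirac_meas.

Let dirac_sub : ereal_sup [set skern_dirac r [set: X] | r in [set: X]] <= 1.
Proof.
apply: ge_ereal_sup => _ [r _ <-].
by rewrite [leLHS]trim_diracE // indicT.
Qed.

HB.instance Definition _ :=
  @Kernel_isSubProbability.Build _ _ X X R skern_dirac dirac_sub.

Definition skern_id : skern_hom X X :=
  @SKernHom X X skern_dirac (fun r => @trim_norm _ _ _ _).

Lemma skern_idE r U : measurable U -> skern_id r U = (\1_U r)%:E.
Proof. by move=> mU; exact: trim_diracE. Qed.

End identity.

Section composition.
Variables (X1 X2 X3 : Ar) (k2 : skern_hom X2 X3) (k1 : skern_hom X1 X2).

Fact skern_comp_norm r : normalized (mkcomp_noparam k1 k2 r).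
Proof.
move=> U mU; rewrite /mkcomp_noparam /= /kcomp_noparam integral0_eq // => y _.
exact: skern_norm.
Qed.

Definition skern_comp : skern_hom X1 X3 :=
  @SKernHom X1 X3 (mkcomp_noparam k1 k2) skern_comp_norm.

Lemma skern_compE r U : skern_comp r U = \int[k1 r]_s k2 s U.
Proof. by []. Qed.

End composition.

Lemma skern_meas (X Y : Ar) (k : skern_hom X Y) U :
  measurable U -> measurable_fun [set: X] (fun r => k r U).
Proof. exact: measurable_kernel. Qed.

Lemma skern_fin (X Y : Ar) (k : skern_hom X Y) r : k r setT < +oo.
Proof. exact: (le_lt_trans (sprob_kernel_le1 k r) (ltry _)). Qed.

Lemma skern_uub (X Y : Ar) (k : skern_hom X Y) : measure_fam_uub k.
Proof.
by exists 2%R => r; apply: le_lt_trans (sprob_kernel_le1 k r) _; rewrite lte1n.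
Qed.

Lemma integral_skern_comp (X1 X2 X3 : Ar) (k2 : skern_hom X2 X3)
    (k1 : skern_hom X1 X2) r (f : X3 -> \bar R) :
  (forall z, 0 <= f z) -> measurable_fun [set: X3] f ->
  \int[skern_comp k2 k1 r]_z f z = \int[k1 r]_y \int[k2 y]_z f z.
Proof.
move=> f0 mf.
by rewrite -(integral_kint (skern_fin k1 r) (skern_meas k2) (skern_uub k2)).
Qed.

Let skern_idl (X Y : Ar) (f : skern_hom X Y) : skern_comp (skern_id Y) f = f.
Proof.
apply: skern_ext => r U mU; rewrite skern_compE.
transitivity (\int[f r]_s (\1_U s)%:E); last by rewrite integral_indic // setIT.
by apply: eq_integral => s _; exact: skern_idE.
Qed.

Let skern_idr (X Y : Ar) (f : skern_hom X Y) : skern_comp f (skern_id X) = f.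
Proof.
apply: skern_ext => r U mU; rewrite skern_compE.
transitivity (\int[\d_r]_s f s U).
  by apply: eq_measure_integral => V mV _; exact: trimE.
by rewrite integral_dirac // ?diracT ?mul1e //; exact: skern_meas.
Qed.

Let skern_compA (X Y Z W : Ar) (h : skern_hom Z W) (g : skern_hom Y Z)
    (f : skern_hom X Y) :
  skern_comp h (skern_comp g f) = skern_comp (skern_comp h g) f.
Proof.
apply: skern_ext => r U mU.
by rewrite skern_compE integral_skern_comp //; exact: skern_meas.
Qed.

Definition SKern : category := {|
  obj := Ar ;
  hom := skern_hom ;
  idc := skern_id ;
  compc := skern_comp ;
  comp_idl := skern_idl ;
  comp_idr := skern_idr ;
  comp_assoc := skern_compA |}.

End skern.

Section sklin.
Context (R : realType) (Ar : arities).
Local Open Scope ereal_scope.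

Section map.
Variables (X Y : Ar) (k : skern_hom R X Y).

Definition sklin_fun (mu : fmeas R X) : fmeas R Y :=
  mk_fmeas (kint_fin (fmeas_ltT mu) (skern_meas k) (skern_uub k))
    (kint_norm (fmeas_ltT mu) (skern_meas k) (skern_uub k) (skern_norm k)).

Lemma sklin_funE mu V : sklin_fun mu V = \int[mu]_r k r V.
Proof. by []. Qed.

Lemma integral_sklin_fun mu (f : Y -> \bar R) :
  (forall z, 0 <= f z) -> measurable_fun [set: Y] f ->
  \int[sklin_fun mu]_z f z = \int[mu]_r \int[k r]_z f z.
Proof.
move=> f0 mf.
by rewrite -(integral_kint (fmeas_ltT mu) (skern_meas k) (skern_uub k)).
Qed.

Let sklin_lin : lin_continuous sklin_fun.
Proof.
have sD mu nu : sklin_fun (mu + nu)%R = (sklin_fun mu + sklin_fun nu)%R.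
  apply: fmeas_ext => V mV; rewrite fmeasD !sklin_funE.
  rewrite -ge0_integral_measure_add //; last exact: skern_meas.
split=> [a mu|mu nu|]; last 2 first.
- exact: sD.
- split=> [mu _ [nu ->]|u x incr _ xlub].
    by exists (sklin_fun nu); exact: sD.
  split=> [n|y uy]; apply/fmeas_leP => V mV.
    have [z ->] := xlub.1 n; rewrite sD fmeasD leeDl //.
  rewrite sklin_funE; apply: (fmeas_integral_lub _ _ incr xlub) => //.
    exact: skern_meas.
  by move=> n; move/fmeas_leP: (uy n); exact.
apply: fmeas_ext => V mV; rewrite fmeasZ !sklin_funE.
by rewrite -[_%:E]/((nnng a)%:num%:E) -ge0_integral_mscale //; exact: skern_meas.
Qed.

Fact sklin_subproof : icone_morphism (Ar := Ar) sklin_fun.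
Proof.
have fam (Z : Ar) (gamma : Z -> fmeas R X) : is_path (Ar := Ar) gamma ->
    measure_fam_uub gamma /\
    forall U, measurable U -> measurable_fun [set: Z] (fun r => gamma r U).
  by move=> /fmeas_pathP.
have le_mass mu : sklin_fun mu setT <= mu setT.
  rewrite sklin_funE -[leRHS]mul1e -integral_cst //.
  apply: ge0_le_integral => //; first exact: skern_meas.
  by move=> r _; exact: sprob_kernel_le1.
split=> //.
- apply/opnorm_le1P => mu mu1; apply: le_trans mu1.
  by rewrite -lee_fin !cnorm_fmeasE !fmeas_fine.
- move=> Z gamma /fam[[M gM] mg]; apply/fmeas_pathP; split.
    by exists M => r; apply: le_lt_trans (gM r); exact: le_mass.
  move=> U mU; apply: (measurable_fun_integral_kernel mg) => //.
  exact: skern_meas.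
- move=> Z gamma mu x /fam[bg mg] /fmeas_integralP xi.
  apply/fmeas_integralP => V mV; rewrite sklin_funE.
  transitivity (\int[kint (finite_measure_ltT mu) mg bg]_r k r V).
    by apply: eq_measure_integral => U mU _; rewrite kintE; exact: xi.
  by rewrite integral_kint //; exact: skern_meas.
Qed.

Definition sklin_hom : icone_hom (fmeas R X : integrableConeType R Ar) (fmeas R Y) :=
  IConeHom sklin_subproof.

End map.

Let sklin_id (X : Ar) : sklin_hom (skern_id R X) = icone_id _.
Proof.
apply: icone_hom_ext => mu; apply: fmeas_ext => V mV.
rewrite -[RHS](integral_fmeas_indic mu) //.
by apply: eq_integral => r _; exact: skern_idE.
Qed.

Let sklin_comp (X Y Z : Ar) (g : skern_hom R Y Z) (f : skern_hom R X Y) :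
  sklin_hom (skern_comp g f) = icone_comp (sklin_hom g) (sklin_hom f).
Proof.
apply: icone_hom_ext => mu; apply: fmeas_ext => V mV.
apply/esym/(integral_sklin_fun f mu) => //; exact: skern_meas.
Qed.

Definition Sklin : functor (SKern R Ar) (ICones R Ar) :=
  @Functor (SKern R Ar) (ICones R Ar)
    (fun X : Ar => fmeas R X : integrableConeType R Ar) sklin_hom sklin_id sklin_comp.

End sklin.

(* Main.v *)
Require Import Defs.
From HB Require Import structures.
From mathcomp Require Import all_boot all_order all_algebra.
From mathcomp Require Import all_classical all_reals all_analysis.
From mathcomp Require Import measurable_realfun.

(** The Dirac masses form a path [X -> M(X)], and every finite measure [mu] is
    the integral of this path over [mu] itself. A morphism [g] of [ICones]
    preserves integrals, so [g mu] is the integral of [r |-> g (delta_r)]: thus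
    [g] is induced by the kernel [r |-> g (delta_r)], and by no other, because
    integrating a kernel against [delta_r] gives it back. *)

Set Implicit Arguments.
Unset Strict Implicit.
Unset Printing Implicit Defensive.
Import Order.TTheory GRing.Theory Num.Theory.
Local Open Scope classical_set_scope.
Local Open Scope ring_scope.
Local Open Scope ereal_scope.

Section dirac_path.
Context (R : realType) (Ar : arities) (X : Ar).

Lemma fdiracE (r : X) U : measurable U -> fdirac R r U = (\1_U r)%:E.
Proof. exact: trim_diracE. Qed.

Lemma fdirac_ball (r : X) : cone_ball (fdirac R r).
Proof. by rewrite /cone_ball /= trim_diracE //= indicT. Qed.

Lemma fdirac_path : is_path (Ar := Ar) (fun r : X => fdirac R r).
Proof.
apply/fmeas_pathP; split.
  (* [measure_fam_uub] asks for a strict bound and Dirac measures have mass 1, hence 2. *)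
  by exists 2%R => r; rewrite -[ltLHS]/(fdirac R r setT) fdiracE // indicT lte_fin ltr1n.
move=> U mU; rewrite (_ : (fun _ => _) = (fun r : X => (\1_U r)%:E)).
  by apply/measurable_EFinP; exact: measurable_indic.
by apply/funext => r; exact: fdiracE.
Qed.

(** Tested on a measurable [U], both sides are the integral of the indicator of [U] against [mu]. *)
Lemma fdirac_integral (mu : fmeas R X) :
  is_integral (Ar := Ar) (fun r : X => fdirac R r) mu mu.
Proof.
apply/fmeas_integralP => U mU; rewrite -[LHS]integral_fmeas_indic //.
by apply: eq_integral => r _; rewrite fdiracE.
Qed.

End dirac_path.

Section kernel_of_morphism.
Context (R : realType) (Ar : arities) (X Y : Ar).
Variable g : icone_hom (fmeas R X : integrableConeType R Ar) (fmeas R Y).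

Definition hom_kernel (r : X) : {measure set Y -> \bar R} := g (fdirac R r).

(** [g] sends the Dirac path to a path, and a path of measures is measurable on each measurable
    set. *)
Let hom_kernel_measurable U : measurable U ->
  measurable_fun [set: X] (hom_kernel ^~ U).
Proof.
case: (icone_funP g) => _ _ gp _ mU.
by have /fmeas_pathP[_] := gp X _ (fdirac_path R X); exact.
Qed.

HB.instance Definition _ :=
  @isKernel.Build _ _ X Y R hom_kernel hom_kernel_measurable.

(** Dirac measures lie in the unit ball, which [g] preserves because its norm is at most 1. *)
Let hom_kernel_sub : ereal_sup [set hom_kernel r [set: Y] | r in [set: X]] <= 1.
Proof.
case: (icone_funP g) => _ /opnorm_le1P g1 _ _.
apply: ge_ereal_sup => _ [r _ <-].
rewrite -[leLHS](fmeas_fine (g (fdirac R r))) lee_fin.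
by have := g1 _ (fdirac_ball R r); rewrite /cone_ball /=.
Qed.

HB.instance Definition _ :=
  @Kernel_isSubProbability.Build _ _ X Y R hom_kernel hom_kernel_sub.

Definition hom_skern : skern_hom R X Y :=
  @SKernHom R Ar X Y hom_kernel (fun r => fmeas_norm (g (fdirac R r))).

Lemma sklin_hom_skern : sklin_hom hom_skern = g.
Proof.
case: (icone_funP g) => _ _ _ gi.
apply: icone_hom_ext => mu; apply: fmeas_ext => V mV.
(* Preservation of integrals turns [g mu V] into the integral of [hom_kernel r V] over [mu], to
   which the left side unfolds. *)
have /fmeas_integralP -> // := gi X _ mu mu (fdirac_path R X) (fdirac_integral mu).
Qed.

End kernel_of_morphism.

Lemma sklin_fun_fdirac (R : realType) (Ar : arities) (X Y : Ar)
    (k : skern_hom R X Y) r V :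
  measurable V -> sklin_fun k (fdirac R r) V = k r V.
Proof.
move=> mV; rewrite sklin_funE.
(* [fdirac R r] is a trimmed Dirac measure: it agrees with [\d_r] on measurable sets, and these
   determine integrals. *)
transitivity (\int[\d_r]_s k s V).
  by apply: eq_measure_integral => U mU _; exact: trimE.
by rewrite integral_dirac // ?diracT ?mul1e //; exact: skern_meas.
Qed.

Theorem theorem6p5 (R : realType) (Ar : arities) :
  full (Sklin R Ar) /\ faithful (Sklin R Ar).
Proof.
split=> [X Y g|X Y k1 k2 e]; first by exists (hom_skern g); exact: sklin_hom_skern.
apply: skern_ext => r V mV; rewrite -!sklin_fun_fdirac //.
have e' : sklin_hom k1 = sklin_hom k2 := e.
have -> // : sklin_fun k1 (fdirac R r) = sklin_fun k2 (fdirac R r).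
by rewrite -[LHS]/(sklin_hom k1 (fdirac R r)) e'.
Qed.
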